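(* Let $n\geq 1$ and let $A_n$ be the surface singularity at the origin of $z^{n+1}=xy$. Let $E_1,\dots,E_n$ be the exceptional curves of its minimal desingularization. Then $\overline{N_i}(A_n)\not\subset\overline{N_j}(A_n)$ for all $i\neq j$. Consequently the Nash conjecture holds for $A_n$: the space of arcs $\mathcal{H}$ of $A_n$ has exactly $n$ irreducible components, as many as there are exceptional curves in the minimal desingularization.
   Context: The base field $k$ is algebraically closed. The dual graph of the minimal desingularization of $A_n$ is a chain of $n$ vertices of weight $2$ (weight $=$ minus self-intersection), and $E_1,\dots,E_n$ are numbered consecutively along the chain. An arc on a surface germ $(S,s)$ is a $k$-morphism $\phi:\operatorname{Spec}k[[t]]\to S$ with $\phi(0)=s$; for $A_n$ it is a triple of power series $(x(t),y(t),z(t))$ without constant term with $z(t)^{n+1}=x(t)y(t)$. The set $\mathcal{H}$ of arcs is regarded as an infinite-dimensional algebraic variety with its Zariski topology: basic open sets are defined by finitely many polynomial inequations on finitely many of the coefficients of the power series defining the arc. $N_i(A_n)$ is the set of arcs whose strict transform (the unique lift $\widetilde\phi$ to the minimal desingularization, for arcs not constant) is transverse to $E_i$ and does not meet the other exceptional components. Transverse means intersection number one: $\widetilde\phi(0)\in E_i$ and the pullback by $\widetilde\phi$ of a local equation of $E_i$ has order $1$ in $t$. $\overline{N_i}(A_n)$ is its Zariski closure in $\mathcal{H}$. It is known that each $N_i$ is irreducible and that $\mathcal{H}=\bigcup_i\overline{N_i}$. *)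

(* Defs.v *)
From HB Require Import structures.
From mathcomp Require Import all_boot all_order all_algebra.
From mathcomp Require Import all_classical topology.
From mathcomp Require Import ring zify.
From mathcomp Require mpoly.
Set Implicit Arguments.
Unset Strict Implicit.
Unset Printing Implicit Defensive.
Import Order.TTheory GRing.Theory.
Local Open Scope classical_set_scope.
Local Open Scope ring_scope.

(* Formal power series k[[t]], given by their coefficients. *)
Record pseries (R : Type) := PSeries { coefs :> nat -> R }.

HB.instance Definition _ (R : Type) := gen_eqMixin (pseries R).
HB.instance Definition _ (R : Type) := gen_choiceMixin (pseries R).

Section PSeriesRing.
Variable R : comNzRingType.
Implicit Types f g h : pseries R.

Lemma pseriesP f g : f =1 g -> f = g.
Proof. by case: f g => f [g] /= /funext ->. Qed.

Definition ps_zero : pseries R := PSeries (fun=> 0).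
Definition ps_opp f : pseries R := PSeries (fun m => - f m).
Definition ps_add f g : pseries R := PSeries (fun m => f m + g m).
Definition ps_one : pseries R := PSeries (fun m => (m == 0)%:R).
Definition ps_mul f g : pseries R :=
  PSeries (fun m => \sum_(l < m.+1) f l * g (m - l)%N).

Fact ps_addA : associative ps_add.
Proof. by move=> f g h; apply: pseriesP => m /=; rewrite addrA. Qed.
Fact ps_addC : commutative ps_add.
Proof. by move=> f g; apply: pseriesP => m /=; rewrite addrC. Qed.
Fact ps_add0 : left_id ps_zero ps_add.
Proof. by move=> f; apply: pseriesP => m /=; rewrite add0r. Qed.
Fact ps_addN : left_inverse ps_zero ps_opp ps_add.
Proof. by move=> f; apply: pseriesP => m /=; rewrite addNr. Qed.

HB.instance Definition _ :=
  GRing.isZmodule.Build (pseries R) ps_addA ps_addC ps_add0 ps_addN.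

Definition ps_trunc N f : {poly R} := \poly_(i < N) f i.

Fact coef_ps_trunc N f l : (ps_trunc N f)`_l = if (l < N)%N then f l else 0.
Proof. exact: coef_poly. Qed.

Fact ps_mul_trunc f g N m : (m < N)%N ->
  ps_mul f g m = (ps_trunc N f * ps_trunc N g)`_m.
Proof.
move=> mN; rewrite coefM /=; apply: eq_bigr => l _; rewrite !coef_ps_trunc.
by rewrite (leq_ltn_trans (leq_subr _ _) mN) (leq_trans (ltn_ord l) mN).
Qed.

Fact ps_mulC : commutative ps_mul.
Proof.
by move=> f g; apply: pseriesP => m; rewrite !(ps_mul_trunc _ _ (ltnSn m)) mulrC.
Qed.

Fact ps_mulA : associative ps_mul.
Proof.
move=> f g h; apply: pseriesP => m.
transitivity ((ps_trunc m.+1 f * ps_trunc m.+1 g * ps_trunc m.+1 h)`_m).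
  rewrite -mulrA coefM /=; apply: eq_bigr => l _; rewrite coef_ps_trunc ltn_ord.
  by congr (_ * _); rewrite -ps_mul_trunc // ltnS leq_subr.
rewrite coefM /=; apply: eq_bigr => l _.
rewrite coef_ps_trunc ltnS leq_subr; congr (_ * _).
by rewrite -ps_mul_trunc.
Qed.

Fact ps_mul1 : left_id ps_one ps_mul.
Proof.
move=> f; apply: pseriesP => m /=; rewrite big_ord_recl /= mul1r subn0.
by rewrite big1 ?addr0 // => l _; rewrite mul0r.
Qed.

Fact ps_mulDl : left_distributive ps_mul ps_add.
Proof.
move=> f g h; apply: pseriesP => m /=; rewrite -big_split /=.
by apply: eq_bigr => l _; rewrite mulrDl.
Qed.

Fact ps_one_neq0 : ps_one != 0.
Proof.
apply/eqP => /(congr1 (fun f : pseries R => f 0)) /= /eqP.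
by rewrite oner_eq0.
Qed.

HB.instance Definition _ := GRing.Zmodule_isComNzRing.Build (pseries R)
  ps_mulA ps_mulC ps_mul1 ps_mulDl ps_one_neq0.

Definition ps_unit : pred (pseries R) := fun f => `[< exists g, g * f = 1 >].
Definition ps_inv f : pseries R :=
  if pselect (exists g, g * f = 1) is left e then xget f [set g | g * f = 1]
  else f.

Fact ps_mulV : {in ps_unit, left_inverse 1 ps_inv *%R}.
Proof.
move=> f /asboolP[g gf]; rewrite /ps_inv; case: pselect => [_|]; last by case; exists g.
exact: (@xgetPex _ f [set g | g * f = 1] (ex_intro _ g gf)).
Qed.

Fact ps_unitP f g : g * f = 1 -> ps_unit f.
Proof. by move=> gf; apply/asboolP; exists g. Qed.

Fact ps_inv_out : {in [predC ps_unit], ps_inv =1 id}.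
Proof.
move=> f /negP nf; rewrite /ps_inv; case: pselect => // e.
by exfalso; apply: nf; apply/asboolP.
Qed.

HB.instance Definition _ := GRing.ComNzRing_hasMulInverse.Build (pseries R)
  ps_mulV ps_unitP ps_inv_out.

End PSeriesRing.

Section PSeriesDomain.
Variable R : idomainType.

Fact ps_mulf_eq0 : GRing.integral_domain_axiom (pseries R).
Proof.
move=> f g fg0; apply/norP => -[f0 g0].
have nz (h : pseries R) : h != 0 -> exists m, h m != 0.
  move=> h0; apply: contrapT => nh; move/eqP: h0; apply; apply: pseriesP => m /=.
  by apply: contrapT => /eqP hm; apply: nh; exists m.
have [a fa amin] := ex_minnP (nz f f0).
have [b gb bmin] := ex_minnP (nz g g0).
have := congr1 (fun h : pseries R => h (a + b)%N) fg0.
have ltab : (a < (a + b).+1)%N by rewrite ltnS leq_addr.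
rewrite /= (bigD1 (Ordinal ltab)) //= addKn big1 ?addr0.
  by move/eqP; rewrite mulf_eq0 (negPf fa) (negPf gb).
move=> l; rewrite -val_eqE /= neq_ltn => /orP[la|al].
  have [-> |/amin] := eqVneq (f l) 0; first by rewrite mul0r.
  by rewrite leqNgt la.
have [-> |/bmin] := eqVneq (g (a + b - l)%N) 0; first by rewrite mulr0.
rewrite leq_subRL; last by rewrite -ltnS ltn_ord.
by rewrite leq_add2r leqNgt al.
Qed.

HB.instance Definition _ :=
  GRing.ComUnitRing_isIntegral.Build (pseries R) ps_mulf_eq0.

End PSeriesDomain.

Section PSeriesDivision.
Variable k : fieldType.
Implicit Types f g : pseries k.

Fact ps_dvd f g a : (forall l, (l < a)%N -> f l = 0) -> f a != 0 ->
  (forall l, (l < a)%N -> g l = 0) -> exists r, g = r * f.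
Proof.
move=> f0 fa g0.
pose next (s : seq k) := let j := size s in
  (g (a + j)%N - \sum_(l < j) s`_l * f (a + j - l)%N) / f a.
pose sol := fix sol j := if j is j'.+1 then rcons (sol j') (next (sol j')) else [::].
have size_sol j : size (sol j) = j by elim: j => //= j IH; rewrite size_rcons IH.
pose r : pseries k := PSeries (fun j => next (sol j)).
have solE j l : (l < j)%N -> (sol j)`_l = r l.
  elim: j => // j IH; rewrite ltnS leq_eqVlt /= nth_rcons size_sol.
  by case/orP => [/eqP ->|lj]; [rewrite ltnn eqxx|rewrite lj IH].
exists r; apply: pseriesP => m.
have -> : (r * f) m = \sum_(l < m.+1) r l * f (m - l)%N by [].
have [ma|am] := ltnP m a.
  rewrite g0 // big1 // => l _.
  by rewrite f0 ?mulr0 // (leq_ltn_trans (leq_subr _ _) ma).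
have [j ->] : exists j, m = (a + j)%N by exists (m - a)%N; rewrite subnKC.
rewrite -(big_mkord xpredT (fun l => r l * f (a + j - l)%N)).
rewrite (@big_cat_nat _ _ _ j.+1) //=; last by rewrite ltnS leq_addl.
have -> : \sum_(j.+1 <= l < (a + j).+1) r l * f (a + j - l)%N = 0.
  by rewrite big_nat big1 // => l /andP[jl lm]; rewrite f0 ?mulr0 //; lia.
rewrite addr0 big_nat_recr //= addnK.
have -> : next (sol j) * f a = g (a + j)%N - \sum_(l < j) r l * f (a + j - l)%N.
  rewrite /next size_sol divfK //; congr (_ - _).
  by apply: eq_bigr => l _; rewrite solE.
by rewrite big_mkord addrC subrK.
Qed.

Lemma ps_dvd_total f g : exists r, f = r * g \/ g = r * f.
Proof.
have nz (h : pseries k) : h != 0 ->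
    exists a, h a != 0 /\ forall l, (l < a)%N -> h l = 0.
  move=> h0; have ex : exists m, h m != 0.
    apply: contrapT => nh; move/eqP: h0; apply; apply: pseriesP => m /=.
    by apply: contrapT => /eqP hm; apply: nh; exists m.
  have [a ha amin] := ex_minnP ex; exists a; split => // l la.
  by apply: contraTeq la => /amin; rewrite leqNgt.
have [-> |/nz[a [fa f0]]] := eqVneq f 0; first by exists 0; left; rewrite mul0r.
have [-> |/nz[b [gb g0]]] := eqVneq g 0; first by exists 0; right; rewrite mul0r.
have [ab|/ltnW ba] := leqP a b.
  have [|r] := ps_dvd f0 fa (g := g); last by exists r; right.
  by move=> l la; rewrite g0 // (leq_trans la).
have [|r] := ps_dvd g0 gb (g := f); last by exists r; left.
by move=> l la; rewrite f0 // (leq_trans la).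
Qed.

End PSeriesDivision.

Definition ps_has_order (R : nzRingType) (f : pseries R) (m : nat) : Prop :=
  (forall l, (l < m)%N -> f l = 0) /\ f m != 0.

(* The minimal desingularization of A_n : z^(n+1) = xy is the gluing of n+1
   affine planes U_0, ..., U_n.  U_c has coordinates u = x / z^c and
   v = z^(c+1) / x, in which the desingularization is the monomial map res_map,
   and U_c is glued to U_d, c < d, by the change of coordinates res_glue (its
   first equation forces the functions inverted on the overlap to be
   invertible).  For d = c + 1 it reads u' = v^-1, v' = u v^2, so the curve
   {u = 0} of U_c and {v' = 0} of U_d form a projective line of self-intersection
   -2; in particular there is no (-1)-curve.  A point of U_c over a ring A is a
   pair of elements of A; when A is local (A = k or A = k[[t]]), every A-point of
   the glued surface lies in some U_c. *)
Record chart_pt (n : nat) (A : Type) :=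
  ChartPt { chart : 'I_n.+1; chart_u : A; chart_v : A }.

Definition res_map (A : comNzRingType) n (p : chart_pt n A) : A * A * A :=
  let c := chart p : nat in let u := chart_u p in let v := chart_v p in
  (u ^+ c.+1 * v ^+ c, u ^+ (n - c) * v ^+ (n.+1 - c), u * v).

Definition res_glue (A : comNzRingType) n (p q : chart_pt n A) : Prop :=
  let e := (chart q - chart p)%N in
  [/\ (chart p < chart q)%N,
      chart_u q * (chart_u p ^+ e.-1 * chart_v p ^+ e) = 1
    & chart_v q = chart_u p ^+ e * chart_v p ^+ e.+1].

(* i : 'I_n stands for the curve E_(i+1): it is {u = 0} in U_i, {v = 0} in
   U_(i+1), and does not meet the other charts. *)
Definition exc_eq (A : comNzRingType) n (i : 'I_n) (p : chart_pt n A) : A :=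
  if chart p == i :> nat then chart_u p
  else if chart p == i.+1 :> nat then chart_v p
  else 1.

Definition exc_curve (k : fieldType) n (i : 'I_n) : set (chart_pt n k) :=
  [set p | exc_eq i p = 0].

Lemma res_map_surface (A : comNzRingType) n (p : chart_pt n A) :
  let: (x, y, z) := res_map p in z ^+ n.+1 = x * y.
Proof.
case: p => c u v; rewrite /res_map /=.
rewrite mulrACA -!exprD exprMn; congr (_ ^+ _ * _ ^+ _).
  by rewrite addSn subnKC // -ltnS ltn_ord.
by rewrite subnKC // ltnW.
Qed.

Lemma res_map_glue (A : comNzRingType) n (p q : chart_pt n A) :
  res_glue p q -> res_map p = res_map q.
Proof.
case: p q => [c u v] [d u' v'] [/=]; set e := (d - c)%N => cd uu' ->.
have [f ef] : exists f, e = f.+1 by exists e.-1; rewrite prednK // subn_gt0.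
have dce : d = (c + e)%N :> nat by rewrite subnKC // ltnW.
move: uu'; rewrite ef /= => uu'.
have E2 : u' * (u ^+ f.+1 * v ^+ f.+2) = u * v.
  by rewrite -[RHS]mul1r -uu' !exprS; ring.
rewrite /res_map /=; congr (_, _, _) => //.
- rewrite [in RHS]exprS -mulrA -[in RHS]exprMn E2 dce ef exprMn.
  transitivity (u' * (u ^+ f * v ^+ f.+1) * (u ^+ c.+1 * v ^+ c)).
    by rewrite uu' mul1r.
  by rewrite addnS !exprS !exprD; ring.
have dn : (d <= n)%N by rewrite -ltnS ltn_ord.
have -> : (n.+1 - d = (n - d).+1)%N by rewrite subSn.
rewrite [in RHS]exprSr [in RHS]mulrA -[in RHS]exprMn E2.
have -> : (n - c = n - d + f.+1)%N.
  by lia.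
have -> : (n.+1 - c = n - d + f.+2)%N.
  rewrite subSn; last by rewrite -ltnS ltn_ord.
  rewrite addnS; congr _.+1.
  by lia.
by rewrite exprMn !exprD; ring.
Qed.

Lemma exc_fibre (k : fieldType) n (p : chart_pt n k) : (0 < n)%N ->
  res_map p = (0, 0, 0) <-> exists i, exc_curve i p.
Proof.
case: p => c u v n0; rewrite /res_map /exc_curve /exc_eq /=; split.
  case=> /eqP; rewrite mulf_eq0 !expf_eq0 /= => x0 /eqP.
  rewrite mulf_eq0 !expf_eq0 !subn_gt0 ltn_ord /= => y0 _.
  have [u0|u0] := eqVneq u 0.
    have [cn|nc] := ltnP c n; first by exists (Ordinal cn); rewrite /= eqxx.
    have v0 : v = 0 by case/orP: y0 => [/andP[]|/eqP //]; rewrite ltnNge nc.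
    have cn : (c.-1 < n)%N by rewrite prednK ?(leq_trans n0) // -ltnS.
    exists (Ordinal cn) => /=; rewrite prednK ?(leq_trans n0) // eqxx.
    by case: ifP => //; rewrite u0.
  move: x0; rewrite (negPf u0) /= => /andP[c0 /eqP v0].
  have cn : (c.-1 < n)%N by rewrite prednK // -ltnS.
  exists (Ordinal cn) => /=; rewrite prednK // eqxx.
  by case: ifP => //; rewrite gtn_eqF // prednK.
case=> i; case: eqP => [ci ->|_]; last case: eqP => [ci ->|_].
- by rewrite ci !expr0n subn_eq0 leqNgt ltn_ord /= !mul0r.
- by rewrite ci !expr0n subn_eq0 leqNgt !ltnS ltn_ord /= !mulr0.
by move/eqP; rewrite oner_eq0.
Qed.

(* Over a domain, res_map is injective up to gluing away from the zero point;
   over a valuation ring it is surjective.  Hence every nonconstant arc has a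
   unique lift (strict_transform_exists, strict_transform_unique below). *)
Lemma res_map_inj (A : idomainType) n (p q : chart_pt n A) : (0 < n)%N ->
  res_map p = res_map q -> res_map p <> (0, 0, 0) ->
  [\/ p = q, res_glue p q | res_glue q p].
Proof.
move=> n0.
wlog pq : p q / (chart p <= chart q)%N.
  move=> H e ne; have [/H|/ltnW /H] := leqP (chart p) (chart q); first exact.
  rewrite -e => /(_ erefl ne) [->||]; [exact: Or31|exact: Or33|exact: Or32].
case: p q pq => [c u v] [d u' v'] /=; rewrite /res_map /= => cd [X Y Z] ne.
have cn : (c <= n)%N by rewrite -ltnS.
have dn : (d <= n)%N by rewrite -ltnS.
have [uv0|uv0] := eqVneq (u * v) 0.
  move: cd; rewrite leq_eqVlt => /orP[/eqP /val_inj dc|cd].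
    apply: Or31; subst d; move/eqP: (uv0); rewrite mulf_eq0 => /orP[]/eqP.
      move=> u0; subst u; move: X Y ne; rewrite !expr0n /= !mul0r => X Y ne.
      have cnn : c = n :> nat.
        by apply/eqP; rewrite eqn_leq cn leqNgt; apply/negP => cn'; apply: ne; rewrite subn_eq0 leqNgt cn' !mul0r.
      move: Y X ne; rewrite cnn subnn !expr0 subSnn !expr1 !mul1r => <- X ne.
      congr ChartPt; apply/eqP; move/eqP: X; rewrite eq_sym mulf_eq0 !expf_eq0 n0 /=.
      by case/orP => [/eqP->//|/eqP v0]; case: ne; rewrite v0.
    move=> v0; subst v; move: X Y ne; rewrite !expr0n /= subn_eq0 ltnNge cn /= !mulr0 => X Y ne.
    have c0 : c = 0%N :> nat.
      by apply/eqP; case: eqP X ne => // _ X; rewrite mulr0; case.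
    move: X Y ne; rewrite c0 !expr0 !expr1 eqxx subn0 !mulr1 => <- Y ne.
    congr ChartPt; apply/esym/eqP; move/eqP: Y; rewrite eq_sym mulf_eq0 !expf_eq0 n0 subn0 /=.
    by case/orP => [/eqP u0|/eqP->//]; case: ne; rewrite u0.
  case: ne; congr (_, _, _) => //.
    rewrite X exprS -mulrA -exprMn -Z uv0 expr0n.
    by rewrite (gtn_eqF (leq_ltn_trans (leq0n _) cd)) mulr0.
  rewrite subSn // exprSr mulrA -exprMn uv0 expr0n subn_eq0 leqNgt.
  by rewrite (leq_trans cd dn) mul0r.
move: cd; rewrite leq_eqVlt => /orP[/eqP /val_inj dc|cd].
  apply: Or31; subst d.
  have uu : u = u'.
    apply: (mulIf (expf_neq0 c uv0)); rewrite {2}Z !exprMn !mulrA -!exprS; exact: X.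
  subst u'; congr ChartPt; apply: (mulfI _ Z); apply: contraNneq uv0 => ->.
  by rewrite mul0r.
apply: Or32; rewrite /res_glue /=; set e := (d - c)%N.
have [f ef] : exists f, e = f.+1 by exists e.-1; rewrite prednK // subn_gt0.
have dce : d = (c + e)%N :> nat by rewrite subnKC // ltnW.
have [u0 v0] : u != 0 /\ v != 0 by move: uv0; rewrite mulf_eq0 => /norP.
have U : u' * (u ^+ f * v ^+ f.+1) = 1.
  have nz : u ^+ c.+1 * v ^+ c != 0 by rewrite mulf_neq0 // expf_neq0.
  apply: (mulIf nz); rewrite mul1r [RHS]X [in RHS]exprS -[in RHS]mulrA.
  rewrite -[in RHS]exprMn -Z [in RHS]exprMn.
  by rewrite dce ef addnS !exprS !exprD; ring.
split; rewrite ?ef //=.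
have u'0 : u' != 0 by apply: contraNneq uv0 => u'0; rewrite Z u'0 mul0r.
by apply: (mulfI u'0); rewrite -Z -[LHS]mul1r -U !exprS; ring.
Qed.

Lemma res_map_surj (A : idomainType) n (x y z : A) : (0 < n)%N ->
  (forall a b : A, exists r, a = r * b \/ b = r * a) ->
  z ^+ n.+1 = x * y -> exists p : chart_pt n A, res_map p = (x, y, z).
Proof.
move=> n0 val xyz; rewrite /res_map.
have [z0|z0] := eqVneq z 0.
  move/eqP: (xyz); rewrite z0 expr0n eq_sym /= mulf_eq0 => /orP[]/eqP w0; rewrite w0.
    exists (ChartPt ord_max 0 y); rewrite /= subnn subSnn !expr0 expr0n /=.
    by rewrite !mul0r mul1r.
  exists (ChartPt ord0 x 0); rewrite /= !subn0 expr0 !expr0n /=.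
  by rewrite expr1 !mulr0 mulr1.
have xy0 : x * y != 0 by rewrite -xyz expf_neq0.
have [x0 y0] : x != 0 /\ y != 0 by move: xy0; rewrite mulf_eq0 => /norP.
pose P c := `[< (c <= n)%N /\ exists u, x = u * z ^+ c >].
have P0 : exists c, P c.
  by exists 0%N; apply/asboolP; split => //; exists x; rewrite mulr1.
have Pn c : P c -> (c <= n)%N by move=> /asboolP[].
have [c /asboolP[cn [u xu]] cmax] := ex_maxnP P0 Pn.
have u0 : u != 0 by apply: contraNneq x0 => u0; rewrite xu u0 mul0r.
have cn1 : (c < n.+1)%N by [].
move: cn; rewrite leq_eqVlt => /orP[/eqP cn|cn].
  subst c; exists (ChartPt (Ordinal cn1) u y) => /=.
  have zE : z = u * y.
    by apply: (mulIf (expf_neq0 n z0)); rewrite -exprS xyz xu mulrAC.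
  rewrite subnn subSnn expr0 expr1 mul1r -zE; congr (_, _, _).
  by rewrite exprS -mulrA -exprMn -zE xu.
have [r [zx|zx]] := val x (z ^+ c.+1).
  suff /cmax : P c.+1 by rewrite ltnn.
  by apply/asboolP; split => //; exists r.
exists (ChartPt (Ordinal cn1) u r) => /=.
have zE : z = u * r.
  apply: (mulIf (expf_neq0 c z0)); rewrite -exprS zx xu; ring.
have xE : u ^+ c.+1 * r ^+ c = x by rewrite exprS -mulrA -exprMn -zE xu.
rewrite -zE xE; congr (_, _, _); apply: (mulfI x0); rewrite -xyz -xE.
rewrite mulrACA -!exprD zE exprMn addSn !subnKC //; exact: ltnW.
Qed.

(* Arcs (x(t), y(t), z(t)) on z^(n+1) = xy centered at the origin. *)
Record an_arc (k : fieldType) (n : nat) := Arc {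
  arc_x : pseries k;
  arc_y : pseries k;
  arc_z : pseries k;
  _ : [/\ arc_x 0 = 0, arc_y 0 = 0 & arc_z 0 = 0];
  _ : arc_z ^+ n.+1 = arc_x * arc_y }.

HB.instance Definition _ (k : fieldType) n := gen_eqMixin (an_arc k n).
HB.instance Definition _ (k : fieldType) n := gen_choiceMixin (an_arc k n).

Definition arc_coord (k : fieldType) n (a : an_arc k n) (j : 'I_3) : pseries k :=
  tnth [tuple arc_x a; arc_y a; arc_z a] j.

(* The inequation P(a) != 0, for a polynomial P in N coefficients of the arc;
   c gives the coordinate and the degree in t of each of them. *)
Definition inequation (k : fieldType) n (N : nat) (c : 'I_N -> 'I_3 * nat)
    (P : mpoly.mpoly N k) : set (an_arc k n) :=
  [set a | mpoly.meval (fun l => arc_coord a (c l).1 (c l).2) P != 0].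

(* The finite intersections of inequations are the basic open sets. *)
HB.instance Definition _ (k : fieldType) n :=
  @isSubBaseTopological.Build (an_arc k n) (set (an_arc k n))
    [set U | exists N c P, U = @inequation k n N c P] id.

Definition arc_nonconstant (k : fieldType) n (a : an_arc k n) : Prop :=
  (arc_x a, arc_y a, arc_z a) <> (0, 0, 0).

Definition strict_transform (k : fieldType) n (a : an_arc k n)
    (psi : chart_pt n (pseries k)) : Prop :=
  arc_nonconstant a /\ res_map psi = (arc_x a, arc_y a, arc_z a).

Lemma strict_transform_exists (k : fieldType) n (a : an_arc k n) : (0 < n)%N ->
  arc_nonconstant a -> exists psi, strict_transform a psi.
Proof.
case: a => x y z a0 aE n0 nc.
have [psi psiE] := res_map_surj n0 (@ps_dvd_total k) aE.
by exists psi.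
Qed.

Lemma strict_transform_unique (k : fieldType) n (a : an_arc k n) psi psi' :
  (0 < n)%N -> strict_transform a psi -> strict_transform a psi' ->
  [\/ psi = psi', res_glue psi psi' | res_glue psi' psi].
Proof.
move=> n0 [nc E] [_ E']; apply: res_map_inj => //; first by rewrite E E'.
by rewrite E.
Qed.

Definition arc_center (k : fieldType) n (psi : chart_pt n (pseries k)) :
    chart_pt n k :=
  ChartPt (chart psi) (chart_u psi 0) (chart_v psi 0).

Definition transverse (k : fieldType) n (psi : chart_pt n (pseries k))
    (i : 'I_n) : Prop :=
  exc_curve i (arc_center psi) /\ ps_has_order (exc_eq i psi) 1.

Definition nash_set (k : fieldType) n (i : 'I_n) : set (an_arc k n) :=
  [set a | exists psi, [/\ strict_transform a psi, transverse psi i &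
    forall j, j != i -> ~ exc_curve j (arc_center psi)]].

Definition irreducible_set (T : topologicalType) (A : set T) : Prop :=
  A !=set0 /\ forall B C : set T, closed B -> closed C ->
    A `<=` B `|` C -> A `<=` B \/ A `<=` C.

Definition irreducible_component (T : topologicalType) (A : set T) : Prop :=
  irreducible_set A /\
  forall B : set T, irreducible_set B -> A `<=` B -> B `<=` A.

(* Main.v *)
Require Import Defs.
From mathcomp Require Import all_boot all_order all_algebra.
From mathcomp Require Import all_classical topology.
From mathcomp Require Import ring zify.
From mathcomp Require mpoly.
Set Implicit Arguments.
Unset Strict Implicit.
Unset Printing Implicit Defensive.
Import GRing.Theory.
Local Open Scope ring_scope.
Local Open Scope classical_set_scope.
Local Open Scope card_scope.

(** Index curves from 0, so that i : 'I_n is E_(i+1).  The closure of N_i lies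
    in the closed set ord x >= i + 1, ord y >= n - i, and both bounds are
    attained on N_i; hence no closure contains another.  Conversely every arc
    lifts to a chart of the resolution, centered on some E_i.  In the affine
    coordinates (u, v) of a chart, two lifts centered on E_i are joined by a
    polynomial curve whose general member is transverse to E_i; pulling
    inequations back along it gives nonzero polynomials in one variable.  This
    shows both that the closures of the N_i cover the arc space and that they
    are irreducible, in any characteristic. *)

(** * Orders of power series *)

Lemma ps_mul_coef0 (R : comNzRingType) (f g : pseries R) :
  (f * g) 0 = f 0 * g 0.
Proof. by rewrite /GRing.mul /= big_ord1 subnn. Qed.

Lemma ps_exp_coef0 (R : comNzRingType) (f : pseries R) e :
  (f ^+ e) 0 = f 0 ^+ e.
Proof. by elim: e => [|e IH] //; rewrite !exprS ps_mul_coef0 IH. Qed.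

Lemma ps_has_orderM (R : idomainType) (f g : pseries R) a b :
  ps_has_order f a -> ps_has_order g b -> ps_has_order (f * g) (a + b).
Proof.
move=> [f0 fa] [g0 gb].
have mulE m : (f * g) m = \sum_(l < m.+1) f l * g (m - l)%N by [].
split=> [m mab|]; rewrite mulE.
  apply: big1 => l _; have [la|al] := ltnP l a; first by rewrite f0 ?mul0r.
  by rewrite g0 ?mulr0 //; have := ltn_ord l; lia.
have ltab : (a < (a + b).+1)%N by rewrite ltnS leq_addr.
rewrite (bigD1 (Ordinal ltab)) //= addKn big1 ?addr0 ?mulf_neq0 //.
move=> l; rewrite -val_eqE /= neq_ltn => /orP[la|al]; first by rewrite f0 ?mul0r.
by rewrite g0 ?mulr0 //; have := ltn_ord l; lia.
Qed.

Lemma ps_has_orderX (R : idomainType) (f : pseries R) a e :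
  ps_has_order f a -> ps_has_order (f ^+ e) (e * a).
Proof.
move=> fa; elim: e => [|e IH]; last by rewrite exprS mulSn; exact: ps_has_orderM.
by split=> //; rewrite expr0 /GRing.one /= oner_eq0.
Qed.

Lemma ps_low_coefMl (R : comNzRingType) (f g : pseries R) a :
  (forall l, (l < a)%N -> f l = 0) -> forall l, (l < a)%N -> (f * g) l = 0.
Proof.
move=> f0 l la; have -> : (f * g) l = \sum_(m < l.+1) f m * g (l - m)%N by [].
by apply: big1 => m _; rewrite f0 ?mul0r // (leq_trans _ la).
Qed.

Lemma ps_low_coefMr (R : comNzRingType) (f g : pseries R) a :
  (forall l, (l < a)%N -> g l = 0) -> forall l, (l < a)%N -> (f * g) l = 0.
Proof. by rewrite mulrC; exact: ps_low_coefMl. Qed.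

Lemma ps_low_coefX (R : comNzRingType) (f : pseries R) e :
  f 0 = 0 -> forall l, (l < e)%N -> (f ^+ e) l = 0.
Proof.
move=> f0; elim: e => // e IH l le; rewrite exprSr.
have -> : (f ^+ e * f) l = \sum_(m < l.+1) (f ^+ e) m * f (l - m)%N by [].
apply: big1 => m _; have [me|em] := ltnP m e; first by rewrite IH ?mul0r.
have -> : (l - m)%N = 0%N by lia.
by rewrite f0 mulr0.
Qed.

(** * Arcs and their lifts to charts *)

Lemma an_arc_eq (k : fieldType) n (a b : an_arc k n) :
  (arc_x a, arc_y a, arc_z a) = (arc_x b, arc_y b, arc_z b) -> a = b.
Proof.
case: a b => [x y z h e] [x' y' z' h' e'] /= [xx yy zz].
by subst; congr Arc; exact: Prop_irrelevance.
Qed.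

(** Evaluation at [t = 0] is multiplicative, so it commutes with a monomial map. *)
Lemma res_map_center (k : fieldType) n (p : chart_pt n (pseries k)) :
  res_map (arc_center p) =
  ((res_map p).1.1 0, (res_map p).1.2 0, (res_map p).2 0).
Proof.
by rewrite /res_map; congr (_, _, _); rewrite ps_mul_coef0 ?ps_exp_coef0.
Qed.

Lemma arc_of_lift (k : fieldType) n (i : 'I_n) (p : chart_pt n (pseries k)) :
  exc_curve i (arc_center p) ->
  exists a : an_arc k n, res_map p = (arc_x a, arc_y a, arc_z a).
Proof.
move=> pi; have n0 : (0 < n)%N by exact: leq_ltn_trans (leq0n _) (ltn_ord i).
have /(exc_fibre _ n0) : exists i, exc_curve i (arc_center p) by exists i.
have : (res_map p).2 ^+ n.+1 = (res_map p).1.1 * (res_map p).1.2.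
  exact: res_map_surface p.
rewrite res_map_center; move: (res_map p) => -[[x y] z] /= e [x0 y0 z0].
by exists (Arc (And3 x0 y0 z0) e).
Qed.

Lemma arc_lift (k : fieldType) n (a : an_arc k n) : (0 < n)%N ->
  exists p (i : 'I_n), res_map p = (arc_x a, arc_y a, arc_z a) /\
    exc_curve i (arc_center p).
Proof.
case: a => x y z [x0 y0 z0] e n0 /=.
have [p pE] := res_map_surj n0 (@ps_dvd_total k) e.
have /(exc_fibre _ n0)[i pi] : res_map (arc_center p) = (0, 0, 0).
  by rewrite res_map_center pE /= x0 y0 z0.
by exists p, i.
Qed.

(** * Polynomial curves of arcs *)

Definition poly_family (k : fieldType) (F : k -> pseries k) : Prop :=
  forall m, exists g : {poly k}, forall s, F s m = g.[s].

Lemma poly_familyM (k : fieldType) (F G : k -> pseries k) :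
  poly_family F -> poly_family G -> poly_family (fun s => F s * G s).
Proof.
move=> /choice[f fE] /choice[g gE] m.
exists (\sum_(l < m.+1) f l * g (m - l)%N) => s.
by rewrite horner_sum; apply: eq_bigr => l _; rewrite fE gE hornerM.
Qed.

Lemma poly_familyX (k : fieldType) (F : k -> pseries k) e :
  poly_family F -> poly_family (fun s => F s ^+ e).
Proof.
move=> FP; elim: e => [m|e IH].
  by exists (m == 0%N)%:R%:P => s; rewrite hornerC.
under [fun s => _]eq_fun do rewrite exprS.
exact: poly_familyM.
Qed.

(* The quadratic path f + s (g - f) + (s^2 - s) t^d from f to g: its t^d
   coefficient is monic in s, hence nonzero for general s. *)
Definition bridge (k : fieldType) (f g : pseries k) (d : nat) (s : k) :
    pseries k :=
  PSeries (fun m => f m + (g m - f m) * s + (m == d)%:R * (s ^+ 2 - s)).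

Definition bridge_coef (k : fieldType) (f g : pseries k) (d m : nat) : {poly k} :=
  (f m)%:P + (g m - f m)%:P * 'X + ((m == d)%:R)%:P * ('X^2 - 'X).

Lemma bridgeE (k : fieldType) (f g : pseries k) d s m :
  bridge f g d s m = (bridge_coef f g d m).[s].
Proof. by rewrite /bridge_coef !hornerE. Qed.

Lemma poly_family_bridge (k : fieldType) (f g : pseries k) d :
  poly_family (bridge f g d).
Proof. by move=> m; exists (bridge_coef f g d m) => s; rewrite bridgeE. Qed.

Lemma bridge0 (k : fieldType) (f g : pseries k) d : bridge f g d 0 = f.
Proof. by apply: pseriesP => m /=; ring. Qed.

Lemma bridge1 (k : fieldType) (f g : pseries k) d : bridge f g d 1 = g.
Proof. by apply: pseriesP => m /=; ring. Qed.

Lemma bridge_coef_neq0 (k : fieldType) (f g : pseries k) d :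
  bridge_coef f g d d != 0.
Proof.
apply/eqP => /(congr1 (fun r : {poly k} => r`_2)) /eqP.
rewrite /bridge_coef eqxx mul1r !(coefD, coefN, coefCM, coefC, coefX, coefXn) /=.
by rewrite mulr0 subr0 !add0r oner_eq0.
Qed.

Lemma bridge_const0 (k : fieldType) (f g : pseries k) d s :
  f 0 = 0 -> g 0 = 0 -> (0 < d)%N -> bridge f g d s 0 = 0.
Proof. by move=> f0 g0 d0; rewrite /= f0 g0 ltn_eqF //=; ring. Qed.

Lemma meval_poly_family (k : fieldType) N (P : mpoly.mpoly N k)
    (F : k -> 'I_N -> k) :
  (forall l, exists g : {poly k}, forall s, F s l = g.[s]) ->
  exists r : {poly k}, forall s, mpoly.meval (F s) P = r.[s].
Proof.
(* The witness is [P] with the polynomials [g l] substituted for its variables. *)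
move=> /choice[g gE]; exists (mpoly.mmap polyC g P) => s.
rewrite /mpoly.meval /mpoly.mmap horner_sum; apply: eq_bigr => m _.
rewrite hornerM hornerC; congr (_ * _); rewrite /mpoly.mmap1 horner_prod.
by apply: eq_bigr => l _; rewrite gE horner_exp.
Qed.

Definition polynomial_curve (k : fieldType) n (a : k -> an_arc k n) : Prop :=
  forall j, poly_family (fun s => arc_coord (a s) j).

(** Unfolds the subbase topology: an open set is a union of finite intersections of inequations. *)
Lemma open_inequations (k : fieldType) n (U : set (an_arc k n)) a :
  open U -> U a -> exists E : seq (set (an_arc k n)),
    [/\ forall X, X \in E -> X a,
        forall b, (forall X, X \in E -> X b) -> U b &
        forall X, X \in E -> exists N c P, X = @inequation k n N c P].
Proof.
move=> [D' D'I <-] [W D'W Wa]; have [E ED WE] := D'I _ D'W.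
exists (finmap.enum_fset E); split=> [X XE|b bE|X XE].
- by have : W a := Wa; rewrite -WE; apply.
- by exists W => //; have : W b by rewrite -WE => X XE; exact: bE.
- by have := ED _ XE; rewrite inE.
Qed.

(** The polynomial is the product of the finitely many pulled-back inequations; it is nonzero
    because no factor vanishes at [s0]. *)
Lemma polynomial_curve_open (k : fieldType) n (a : k -> an_arc k n)
    (U : set (an_arc k n)) s0 :
  polynomial_curve a -> open U -> U (a s0) ->
  exists2 r : {poly k}, r != 0 & forall s, r.[s] != 0 -> U (a s).
Proof.
move=> aP oU /(open_inequations oU)[E [Es0 EU EP]].
have /choice[r rE] (X : set (an_arc k n)) : exists r : {poly k}, X \in E ->
    r.[s0] != 0 /\ forall s, r.[s] != 0 -> X (a s).
  (* Choice ranges over all sets [X], so those outside [E] get the dummy value 0. *)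
  have [XE|] := boolP (X \in E); last by exists 0.
  have [N [c [P XP]]] := EP _ XE.
  have [l|r rE] := @meval_poly_family k N P
    (fun s l => arc_coord (a s) (c l).1 (c l).2); first exact: aP.
  exists r => _; split; last by move=> s; rewrite XP /inequation /= -rE.
  by have := Es0 _ XE; rewrite XP /inequation /= rE.
have rN0 s : (\prod_(X <- E) r X).[s] != 0 -> forall X, X \in E -> (r X).[s] != 0.
  by rewrite horner_prod prodf_seq_neq0 => /allP.
exists (\prod_(X <- E) r X); last first.
  by move=> s /rN0 rs; apply: EU => X XE; apply: (rE X XE).2; exact: rs.
have : (\prod_(X <- E) r X).[s0] != 0.
  by rewrite horner_prod prodf_seq_neq0; apply/allP => X /rE[].
by apply: contraNneq => ->; rewrite horner0.
Qed.

(** * Generic lifts *)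

(* The lift avoids the other curves and is transverse to E_i, with nonzero
   second coordinate at t = 0 even when that coordinate axis is not exceptional.
   Unlike nash_set, this can be read in either of the charts i and i + 1. *)
Definition generic_lift (k : fieldType) n (i : 'I_n)
    (p : chart_pt n (pseries k)) : Prop :=
  let e := chart p == i :> nat in
  [/\ exc_curve i (arc_center p), chart_u p e != 0 & chart_v p (~~ e) != 0].

Lemma exc_curve_chart (k : fieldType) n (i : 'I_n) (p : chart_pt n k) :
  exc_curve i p -> chart p = i :> nat /\ chart_u p = 0 \/
                   chart p = i.+1 :> nat /\ chart_v p = 0.
Proof.
rewrite /exc_curve /exc_eq /=; case: eqP => [-> ->|_]; first by left.
by case: eqP => [-> ->|_ /eqP]; [right | rewrite oner_eq0].
Qed.

(** The quadratic term keeps the bridge nonconstant even for [p = q]. That case moves one lift to a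
    nearby generic one; two lifts with different open sets serve for irreducibility. *)
Lemma generic_lift_deform (k : closedFieldType) n (i : 'I_n)
    (p q : chart_pt n (pseries k)) (a b : an_arc k n) (U V : set (an_arc k n)) :
  chart p = chart q ->
  exc_curve i (arc_center p) -> exc_curve i (arc_center q) ->
  res_map p = (arc_x a, arc_y a, arc_z a) ->
  res_map q = (arc_x b, arc_y b, arc_z b) ->
  open U -> open V -> U a -> V b ->
  exists c r, [/\ U c, V c, res_map r = (arc_x c, arc_y c, arc_z c),
    chart r = chart p & generic_lift i r].
Proof.
case: p q => [c u v] [c' u' v'] /= <- {c'} pi qi pa qb oU oV Ua Vb.
(* Read as a degree, [e] is 1 in chart [i], where [u] is the equation of the curve, and 0 in chart
   [i + 1], where [v] is. The equation is thus perturbed in degree 1, so the center stays on the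
   curve, and the other coordinate in degree 0. *)
pose e := c == i :> nat.
pose w s := ChartPt c (bridge u u' e s) (bridge v v' (~~ e) s).
have wi s : exc_curve i (arc_center (w s)).
  rewrite /exc_curve /exc_eq /=.
  case/exc_curve_chart: pi => /= -[cE z0]; case/exc_curve_chart: qi => /= -[cE' z0'].
  - by rewrite {1}cE eqxx /e cE eqxx; exact: (@bridge_const0 _ u u' 1).
  - lia.
  - lia.
  - have ei : e = false by apply/eqP; lia.
    by rewrite -/e ei cE eqxx; exact: (@bridge_const0 _ v v' 1).
have /choice[g gE] s := arc_of_lift (wi s).
have gP : polynomial_curve g.
  have [uP vP] : poly_family (fun s => chart_u (w s)) /\
                 poly_family (fun s => chart_v (w s)).
    by split; exact: poly_family_bridge.
  case=> -[|[|[|//]]] jP; rewrite /arc_coord /tnth /=.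
  - have -> : (fun s => arc_x (g s)) =
        (fun s => chart_u (w s) ^+ c.+1 * chart_v (w s) ^+ c).
      by apply/funext => s; case: (gE s).
    by apply: poly_familyM; exact: poly_familyX.
  - have -> : (fun s => arc_y (g s)) =
        (fun s => chart_u (w s) ^+ (n - c) * chart_v (w s) ^+ (n.+1 - c)).
      by apply/funext => s; case: (gE s).
    by apply: poly_familyM; exact: poly_familyX.
  - have -> : (fun s => arc_z (g s)) = (fun s => chart_u (w s) * chart_v (w s)).
      by apply/funext => s; case: (gE s).
    exact: poly_familyM.
have g0 : g 0 = a by apply: an_arc_eq; rewrite -gE -pa /w !bridge0.
have g1 : g 1 = b by apply: an_arc_eq; rewrite -gE -qb /w !bridge1.
rewrite -g0 in Ua; rewrite -g1 in Vb.
have [r1 r10 r1U] := polynomial_curve_open gP oU Ua.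
have [r2 r20 r2V] := polynomial_curve_open gP oV Vb.
(* Off the roots of [r] the arc lies in both open sets and the two coefficients tested by
   [generic_lift] are nonzero. *)
pose r := r1 * r2 * bridge_coef u u' e e * bridge_coef v v' (~~ e) (~~ e).
have r0 : r != 0 by rewrite !mulf_neq0 ?bridge_coef_neq0.
have /(closed_nonrootP r)[s] := r0.
rewrite /root /r !hornerM -!bridgeE !mulf_eq0 !negb_or -!andbA.
case/and4P=> rs1 rs2 us vs.
by exists (g s), (w s); split; [exact: r1U | exact: r2V | exact: gE | |split].
Qed.

(** A generic lift in chart [i + 1] has a unit [u] as first coordinate, so it lies in the overlap
    with chart [i]. Inverting the gluing gives the coordinates [u^2 v] and [u^-1] there. *)
Lemma generic_lift_chart (k : fieldType) n (i : 'I_n)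
    (p : chart_pt n (pseries k)) :
  generic_lift i p -> exists q,
    [/\ chart q = i :> nat, generic_lift i q & res_map q = res_map p].
Proof.
move=> pg; have [pi _ _] := pg.
case/exc_curve_chart: pi => -[/= cE z0]; first by exists p.
case: p cE z0 pg => c u v /= cE v0.
have e : (c == i :> nat) = false by rewrite cE gtn_eqF.
rewrite /generic_lift /= e /= => -[_ u0 v1].
have [//|//|w wu] := @ps_dvd k u 1 0 _ u0.
have iP : (i < n.+1)%N by rewrite ltnS ltnW.
have w0 : w 0 != 0.
  have := congr1 (fun f : pseries k => f 0) wu; rewrite ps_mul_coef0.
  have -> : (1 : pseries k) 0 = 1 by [].
  by move=> wu0; apply/eqP => w0; move: wu0 => /eqP; rewrite w0 mul0r oner_eq0.
have uuv0 : (u * u * v) 0 = 0 by rewrite ps_mul_coef0 v0 mulr0.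
have uuv1 : (u * u * v) 1 != 0.
  have ou : ps_has_order u 0 by [].
  have ov : ps_has_order v 1 by split=> // -[|].
  exact: (ps_has_orderM (ps_has_orderM ou ou) ov).2.
exists (ChartPt (Ordinal iP) (u * u * v) w); split=> //.
  rewrite /generic_lift [chart _]/= eqxx; split=> //.
  by rewrite /exc_curve /exc_eq /= eqxx; exact: uuv0.
apply: res_map_glue; rewrite /res_glue /= cE subSnn expr0 !expr1 mul1r.
split=> //; first by rewrite mulrC -wu.
have -> : u * u * v * (w * w) = (w * u) * (w * u) * v by ring.
by rewrite -wu !mul1r.
Qed.

(** In chart [i] the orders of [u] and [v] are 1 and 0, so the orders of x and y are the exponents
    of [u] in the two monomials. The finite order of x makes the arc nonconstant. *)
Lemma generic_lift_nash (k : fieldType) n (i : 'I_n) (a : an_arc k n)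
    (p : chart_pt n (pseries k)) :
  generic_lift i p -> res_map p = (arc_x a, arc_y a, arc_z a) ->
  nash_set i a /\ (ps_has_order (arc_x a) i.+1 /\ ps_has_order (arc_y a) (n - i)).
Proof.
move=> /generic_lift_chart[q [cE]] + <- => /[swap].
case: q cE => c u v /= cE; rewrite /generic_lift /= cE eqxx.
move=> qa [qi u1 v0].
have {}qi : u 0 = 0 by move: qi; rewrite /exc_curve /exc_eq /= cE eqxx.
have ou : ps_has_order u 1 by split=> // -[|].
have ov : ps_has_order v 0 by [].
have [ox oy] : ps_has_order (arc_x a) i.+1 /\ ps_has_order (arc_y a) (n - i).
  move: qa; rewrite /res_map /= cE => -[<- <- _]; split.
    have := ps_has_orderM (ps_has_orderX i.+1 ou) (ps_has_orderX i ov).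
    by rewrite muln1 muln0 addn0.
  have := ps_has_orderM (ps_has_orderX (n - i) ou) (ps_has_orderX (n.+1 - i) ov).
  by rewrite muln1 muln0 addn0.
split=> //; exists (ChartPt c u v); split.
- by split=> // -[x0 _ _]; case: ox => _; rewrite x0 eqxx.
- by split; rewrite /exc_curve /exc_eq /= cE eqxx.
move=> j ji; rewrite /exc_curve /exc_eq /= cE.
rewrite eq_sym (inj_eq val_inj) (negPf ji).
by case: ifP => _; apply/eqP; rewrite ?oner_eq0.
Qed.

(** * Covering and irreducibility *)

Lemma nash_set_lift (k : fieldType) n (i : 'I_n) (a : an_arc k n) :
  nash_set i a -> exists p, res_map p = (arc_x a, arc_y a, arc_z a) /\
    exc_curve i (arc_center p).
Proof. by case=> p [[_ pa] [pi _] _]; exists p. Qed.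

(** The lift may be tangent to the curve, lie inside it or start at a crossing: every neighbourhood
    still contains a generic deformation. *)
Lemma closure_nash_of_lift (k : closedFieldType) n (i : 'I_n) (a : an_arc k n) p :
  res_map p = (arc_x a, arc_y a, arc_z a) -> exc_curve i (arc_center p) ->
  closure (@nash_set k n i) a.
Proof.
move=> pa pi B; rewrite nbhsE => -[U [oU Ua] UB].
have [c [r [Uc _ rc _ rg]]] :=
  generic_lift_deform erefl pi pi pa pa oU oU Ua Ua.
by exists c; split; [exact: (generic_lift_nash rg rc).1 | exact: UB].
Qed.

Lemma closure_nash_cover (k : closedFieldType) n (a : an_arc k n) :
  (0 < n)%N -> exists i, closure (@nash_set k n i) a.
Proof.
move=> n0; have [p [i [pa pi]]] := arc_lift a n0.
by exists i; exact: closure_nash_of_lift pa pi.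
Qed.

Lemma nash_set_generic (k : closedFieldType) n (i : 'I_n) :
  exists2 a, nash_set i a &
    ps_has_order (arc_x a) i.+1 /\ @ps_has_order k (arc_y a) (n - i).
Proof.
have iP : (i < n.+1)%N by rewrite ltnS ltnW.
(* A lift of the constant arc; it is deformed with no open condition imposed. *)
pose p : chart_pt n (pseries k) := ChartPt (Ordinal iP) 0 0.
have pi : exc_curve i (arc_center p) by rewrite /exc_curve /exc_eq /= eqxx.
have [a pa] := arc_of_lift pi.
have [c [r [_ _ rc _ rg]]] :=
  generic_lift_deform erefl pi pi pa pa openT openT I I.
by have [? ?] := generic_lift_nash rg rc; exists c.
Qed.

(* Two arcs of N_i outside B and C may lift to different charts; each is first
   moved to a generic one, which lifts to chart i. *)
Lemma closure_nash_irreducible (k : closedFieldType) n (i : 'I_n) :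
  irreducible_set (closure (@nash_set k n i)).
Proof.
split; first by have [a /subset_closure ia _] := nash_set_generic k i; exists a.
move=> B C cB cC NBC; apply: contrapT => /not_orP[NB NC].
have out (D : set (an_arc k n)) : closed D ->
    ~ closure (@nash_set k n i) `<=` D -> exists a p,
    [/\ ~ D a, res_map p = (arc_x a, arc_y a, arc_z a),
        exc_curve i (arc_center p) & chart p = i :> nat].
  move=> cD ND; have [a [ia Da]] : exists a, nash_set i a /\ ~ D a.
    apply: contrapT => H; apply: ND.
    rewrite [D in _ `<=` D]((closure_id D).1 cD); apply: closure_subset => a ia.
    by apply: contrapT => Da; apply: H; exists a.
  have [p [pa pi]] := nash_set_lift ia.
  have oD : open (~` D) by exact: closed_openC.
  have [c [r [Dc _ rc _ rg]]] :=
    generic_lift_deform erefl pi pi pa pa oD oD Da Da.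
  have [q [qi qg qr]] := generic_lift_chart rg.
  by exists c, q; split=> //; [rewrite qr | case: qg].
have [a [p [Ba pa pi pE]]] := out _ cB NB.
have [b [q [Cb qb qi qE]]] := out _ cC NC.
have pq : chart p = chart q by apply: val_inj; rewrite /= pE.
have [c [r [Bc Cc rc _ rg]]] := generic_lift_deform pq pi qi pa qb
  (closed_openC cB) (closed_openC cC) Ba Cb.
by have /subset_closure/NBC[] := (generic_lift_nash rg rc).1.
Qed.

(** * Order bounds and absence of inclusions *)

Lemma closed_coef_eq0 (k : fieldType) n (j : 'I_3) m :
  closed [set a : an_arc k n | arc_coord a j m = 0].
Proof.
rewrite -openC.
have -> : ~` [set a : an_arc k n | arc_coord a j m = 0] =
    @inequation k n 1 (fun=> (j, m)) (mpoly.mpolyX k (mpoly.mnm1 ord0)).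
  apply/seteqP; split=> a; rewrite /inequation /= mpoly.mevalXU => /eqP //.
exists [set @inequation k n 1 (fun=> (j, m)) (mpoly.mpolyX k (mpoly.mnm1 ord0))].
  move=> _ ->; apply: finI_from1.
  by exists 1%N, (fun=> (j, m)), (mpoly.mpolyX k (mpoly.mnm1 ord0)).
by rewrite bigcup_set1.
Qed.

(** In both charts the equation of the curve enters x with exponent [i + 1] and y with exponent
    [n - i]. The resulting vanishing of coefficients is a closed condition. *)
Lemma closure_nash_orders (k : fieldType) n (i : 'I_n) (a : an_arc k n) :
  closure (@nash_set k n i) a ->
  (forall l, (l < i.+1)%N -> arc_x a l = 0) /\
  (forall l, (l < n - i)%N -> arc_y a l = 0).
Proof.
have sub j m : (forall b : an_arc k n, nash_set i b -> arc_coord b j m = 0) ->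
    closure (@nash_set k n i) a -> arc_coord a j m = 0.
  move=> H /(@closure_subset _ _ [set b | arc_coord b j m = 0] H).
  by rewrite -((closure_id _).1 (@closed_coef_eq0 k n j m)).
have key (b : an_arc k n) : nash_set i b ->
  (forall l, (l < i.+1)%N -> arc_x b l = 0) /\
  (forall l, (l < n - i)%N -> arc_y b l = 0).
  case=> -[c u v] [[_ bE] [bi [lo _]] _].
  move: bE; rewrite /res_map /= => -[<- <- _].
  move: lo; case/exc_curve_chart: bi => /= -[cE _]; rewrite /exc_eq /= cE.
    by rewrite eqxx => u0; split; apply: ps_low_coefMl; apply: ps_low_coefX; exact: u0.
  rewrite gtn_eqF // eqxx subSS => v0.
  by split; apply: ps_low_coefMr; apply: ps_low_coefX; exact: v0.
move=> ia; split=> l ll.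
  exact: (sub ord0 l (fun b bi => (key b bi).1 l ll) ia).
exact: (sub (Ordinal (isT : (1 < 3)%N)) l (fun b bi => (key b bi).2 l ll) ia).
Qed.

(** For a generic arc of index [i], the order of x is too small if [i < j], and that of y if
    [j < i]. *)
Lemma closure_nash_not_sub (k : closedFieldType) n (i j : 'I_n) : i != j ->
  ~ (closure (@nash_set k n i) `<=` closure (@nash_set k n j)).
Proof.
move=> ij sub; have [a ia [[_ xa] [_ ya]]] := nash_set_generic k i.
have [x0 y0] := closure_nash_orders (sub _ (subset_closure ia)).
have : val i != val j by rewrite val_eqE.
rewrite neq_ltn => /orP[lij|lji].
  by move: xa; rewrite x0 ?eqxx.
by move: ya; rewrite y0 ?eqxx //; have := ltn_ord i; rewrite /= in lji *; lia.
Qed.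

(** * Irreducible components and their number *)

Lemma irreducible_sub_bigcup (T : topologicalType) (I : finType) (A : set T)
    (F : I -> set T) :
  irreducible_set A -> (forall i, closed (F i)) ->
  (forall x, A x -> exists i, F i x) -> exists i, A `<=` F i.
Proof.
move=> [[x0 Ax0] irr] cF cov.
have : forall x, A x -> exists2 i, i \in enum I & F i x.
  by move=> x /cov[i Fi]; exists i => //; rewrite mem_enum.
(* One closed set is split off at a time; the point [x0] excludes the empty list. *)
elim: (enum I) => [/(_ _ Ax0)[]//|i s IH H].
have [|x Ax|Ai|As] := irr (F i) (\bigcup_(j in [set` s]) F j) (cF i).
- by apply: closed_bigcup.
- have [j] := H x Ax; rewrite inE => /orP[/eqP ->|js Fj]; first by left.
  by right; exists j.
- by exists i.
by apply: IH => x /As[j js Fj]; exists j.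
Qed.

Lemma irreducible_component_nash (k : closedFieldType) n : (0 < n)%N ->
  [set Z : set (an_arc k n) | irreducible_component Z] =
  (fun i => closure (@nash_set k n i)) @` [set: 'I_n].
Proof.
move=> n0.
have inN (B : set (an_arc k n)) : irreducible_set B ->
    exists i, B `<=` closure (@nash_set k n i).
  move=> irrB; apply: irreducible_sub_bigcup => // [i|x _].
    exact: closed_closure.
  exact: closure_nash_cover.
apply/seteqP; split=> [A [irrA maxA]|_ [i _ <-]].
  have [i Ai] := inN _ irrA; exists i => //; apply/seteqP; split=> //.
  by apply: maxA => //; exact: closure_nash_irreducible.
split=> [|B irrB iB]; first exact: closure_nash_irreducible.
have [j Bj] := inN _ irrB; have [-> //|ij] := eqVneq i j.
by case: (closure_nash_not_sub ij (subset_trans iB Bj)).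
Qed.

(** The point [(0, 1)] of chart [i] lies on the curve of index [i] and on no other. *)
Lemma exc_curve_inj (k : fieldType) n : injective (@exc_curve k n).
Proof.
move=> i j ij; have iP : (i < n.+1)%N by rewrite ltnS ltnW.
have : exc_curve j (ChartPt (Ordinal iP) 0 1 : chart_pt n k).
  by rewrite -ij /exc_curve /exc_eq /= eqxx.
case/exc_curve_chart => /= -[]; first by move=> /val_inj.
by move=> _ /eqP; rewrite oner_eq0.
Qed.

Theorem mainTheorem4 (k : closedFieldType) (n : nat) (hn : (1 <= n)%N) :
  (forall i j : 'I_n, i != j ->
     ~ (closure (@nash_set k n i) `<=` closure (@nash_set k n j))) /\
  [set Z : set (an_arc k n) | irreducible_component Z] #= `I_n /\
  [set Z : set (an_arc k n) | irreducible_component Z] #=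
    [set E : set (chart_pt n k) | exists i : 'I_n, E = exc_curve i].
Proof.
have Zcard : [set Z : set (an_arc k n) | irreducible_component Z] #=
    [set: 'I_n].
  rewrite irreducible_component_nash //; apply: inj_card_eq => i j _ _ /= ij.
  apply: contrapT => /eqP ne; apply: (@closure_nash_not_sub k _ _ _ ne).
  by rewrite ij.
split; first exact: closure_nash_not_sub.
split; first exact: card_eq_trans Zcard (card_esym card_II).
apply: (card_eq_trans Zcard).
have -> : [set E : set (chart_pt n k) | exists i : 'I_n, E = exc_curve i] =
    @exc_curve k n @` [set: 'I_n].
  by apply/seteqP; split=> [E [i ->]|_ [i _ <-]]; exists i.
by apply/card_esym/inj_card_eq => i j _ _; exact: exc_curve_inj.
Qed.
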